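(* Let $(x_k)_{k\in\mathbb{N}}$, $(\tilde x_k)_{k\in\mathbb{N}}$, $(v_k)_{k\in\mathbb{N}}$ and $(\varepsilon_k)_{k\in\mathbb{N}}$ be (infinite) sequences generated by the IPG-ELS method applied to $\min_{x\in\mathbb{E}} F(x)=f(x)+g(x)$, and define $w_k:=v_k+x_k-\tilde x_k+\nabla f(\tilde x_k)-\nabla f(x_k)$ for every $k\in\mathbb{N}$. Then $$w_k\in\nabla f(\tilde x_k)+\partial_{\varepsilon_k}g(\tilde x_k)\subseteq\partial_{\varepsilon_k}F(\tilde x_k)\qquad\forall k\in\mathbb{N}.$$ Additionally, if $\alpha\in(0,1-\tau)$ and $\nabla f$ is $L$-Lipschitz continuous on $\mathrm{dom}\,g$, then, given a tolerance $\eta>0$, the IPG-ELS method generates an $\eta$-approximate stationary solution $\tilde x_k$ with residual pair $(w_k,\varepsilon_k)$ in at most $k=O(1/\eta^2)$ iterations; that is, there is a constant $C>0$ independent of $\eta$ such that for all sufficiently small $\eta>0$ there is an index $k\le C/\eta^2$ with $w_k\in\nabla f(\tilde x_k)+\partial_{\varepsilon_k}g(\tilde x_k)$ and $\max\{\|w_k\|,\varepsilon_k\}\le\eta$.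
   Context: Setting. $\mathbb{N}=\{0,1,2,\dots\}$. $\mathbb{E}$ is a finite-dimensional Euclidean space with inner product $\langle\cdot,\cdot\rangle$ and norm $\|\cdot\|=\sqrt{\langle\cdot,\cdot\rangle}$; $g:\mathbb{E}\to\mathbb{R}\cup\{+\infty\}$ is proper, lower semicontinuous and convex; $f:\mathbb{E}\to\mathbb{R}$ is continuously differentiable and convex. $F:=f+g$, $F_*$ is the optimal value of $\min_{x\in\mathbb{E}}F(x)$ and $S_*$ its set of minimizers; it is assumed that $S_*\neq\emptyset$. $\mathrm{dom}\,g=\{x: g(x)<+\infty\}$. For $\varepsilon\ge 0$ and $x\in\mathrm{dom}\,g$, $\partial_\varepsilon g(x):=\{v\in\mathbb{E}: g(y)\ge g(x)+\langle v,y-x\rangle-\varepsilon\ \ \forall y\in\mathbb{E}\}$, and $\partial_\varepsilon g(x)=\emptyset$ if $x\notin\mathrm{dom}\,g$; $\partial_\varepsilon F$ is defined in the same way. Approximate stationarity. Given $\eta>0$, $\tilde x\in\mathrm{dom}\,g$ is an $\eta$-approximate stationary solution with residual pair $(v,\varepsilon)$ if $v\in\nabla f(\tilde x)+\partial_\varepsilon g(\tilde x)$ and $\max\{\|v\|,\varepsilon\}\le\eta$. IPG-ELS method (Inexact Proximal Gradient method with an Explicit Linesearch). Parameters: $x_0\in\mathrm{dom}\,g$, $\tau\in(0,1]$, $\theta\in(0,1)$, $\gamma_1>1$, $\gamma_2\ge 1$, $\alpha\in[0,1-\tau]$. Set $k=0$. Step 2: find any triple $(\tilde x_k,v_k,\varepsilon_k)\in\mathbb{E}\times\mathbb{E}\times[0,\infty)$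 such that $$v_k\in\nabla f(x_k)+\partial_{\varepsilon_k}g(\tilde x_k)+\tilde x_k-x_k,$$ $$g(\tilde x_k-v_k)-g(\tilde x_k)-\langle\nabla f(x_k),v_k\rangle+\tfrac{1+\gamma_1}{2}\|v_k\|^2+(1+\gamma_2)\varepsilon_k\le\tfrac{1-\tau-\alpha}{2}\|x_k-\tilde x_k\|^2.$$ Step 3: if $\tilde x_k=x_k$, stop. Step 4 (linesearch): put $y_k:=\tilde x_k-v_k$ and start with $\beta=1$. If $$f(x_k+\beta(y_k-x_k))\le f(x_k)+\beta\langle\nabla f(x_k),y_k-x_k\rangle+\tfrac{\beta\tau}{2}\|x_k-\tilde x_k\|^2+\tfrac{\gamma_1}{2}\beta\|v_k\|^2+\beta\gamma_2\varepsilon_k,$$ set $\beta_k=\beta$, $x_{k+1}=x_k+\beta_k(y_k-x_k)$, $k:=k+1$ and return to Step 2; otherwise replace $\beta$ by $\theta\beta$ and test the inequality again. *)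

(* Defs.v *)
From HB Require Import structures.
From mathcomp Require Import all_boot all_order all_algebra.
From mathcomp Require Import all_classical all_reals all_analysis.

Set Implicit Arguments.
Unset Strict Implicit.
Unset Printing Implicit Defensive.

Import Order.TTheory GRing.Theory Num.Theory.
Import numFieldNormedType.Exports.

Local Open Scope classical_set_scope.
Local Open Scope ring_scope.

(* A Euclidean space is an [E : finDimNormedModType R] together with
   [dot : {dot E for idfun}] (a symmetric, bilinear, positive definite form)
   such that [`|x| = Num.sqrt (dot x x)]; the topology of [E] is then the one
   of the Euclidean norm. *)
#[short(type="finDimNormedModType")]
HB.structure Definition FinDimNormedModule (R : realType) :=
  {E of NormedModule R E & Vector R E}.

Section ConvexAnalysis.
Context {R : realType} {E : finDimNormedModType R} (dot : {dot E for idfun}).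
Implicit Types (f : E -> R) (g : E -> \bar R) (x v : E) (eps : R).

Definition edom g : set E := [set x | (g x < +oo)%E].

Definition eproper g : Prop := (forall x, (-oo < g x)%E) /\ edom g !=set0.

(* In [\bar R], [0 * +oo = 0], so the inequality is trivial for t = 0, 1. *)
Definition econvex g : Prop := forall (t : R) (x y : E), 0 <= t <= 1 ->
  (g (t *: x + (1 - t) *: y)%R <= t%:E * g x + (1 - t)%R%:E * g y)%E.

Definition eminimizers g : set E := [set x | forall y : E, (g x <= g y)%E].

(* The Riesz representative of the differential; it is the gradient only at
   points where [f] is differentiable. *)
Definition gradient f x : E := get [set v | forall h : E, 'd f x h = dot v h].

Definition continuously_differentiable f : Prop :=
  (forall x, differentiable f x) /\ continuous (gradient f).

Definition eps_subdiff eps g x : set E :=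
  [set v | edom g x /\
           forall y : E, (g x + (dot v (y - x)%R)%:E - eps%:E <= g y)%E].

Definition objective f g x : \bar R := ((f x)%:E + g x)%E.

Definition grad_plus_eps_subdiff f g eps x : set E :=
  [set gradient f x + u | u in eps_subdiff eps g x].

Definition approx_stationary f g (eta : R) x v eps : Prop :=
  [/\ edom g x, grad_plus_eps_subdiff f g eps x v &
      Num.max `|v| eps <= eta].

End ConvexAnalysis.

Section IPG_ELS.
Context {R : realType} {E : finDimNormedModType R} (dot : {dot E for idfun}).
Context (f : E -> R) (g : E -> \bar R) (tau theta gamma1 gamma2 alpha : R).

Definition inexact_prox (x xt v : E) (eps : R) : Prop :=
  [/\ 0 <= eps,
      [set gradient dot f x + u + xt - x | u in eps_subdiff dot eps g xt] v &
      (g (xt - v)%R - g xt - (dot (gradient dot f x) v)%:E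
         + ((1 + gamma1) / 2 * `|v| ^+ 2)%R%:E + ((1 + gamma2) * eps)%R%:E
       <= ((1 - tau - alpha) / 2 * `|x - xt| ^+ 2)%R%:E)%E].

Definition linesearch_test (x xt v : E) (eps beta : R) : Prop :=
  let y := xt - v in
  f (x + beta *: (y - x)) <=
    f x + beta * dot (gradient dot f x) (y - x)
    + beta * tau / 2 * `|x - xt| ^+ 2
    + gamma1 / 2 * beta * `|v| ^+ 2 + beta * gamma2 * eps.

(* Backtracking from 1: [beta] is the first of 1, theta, theta^2, ... that
   passes the test. *)
Definition linesearch_step (x xt v : E) (eps beta : R) : Prop :=
  exists j : nat, [/\ beta = theta ^+ j,
    linesearch_test x xt v eps (theta ^+ j) &
    forall i : nat, (i < j)%N -> ~ linesearch_test x xt v eps (theta ^+ i)].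

(* Infinite runs of the method: the stopping test [xt k = x k] never succeeds
   and every line search terminates. *)
Definition ipg_els_run (x0 : E) (x xt v : nat -> E) (eps : nat -> R) : Prop :=
  x 0%N = x0 /\
  forall k, [/\ inexact_prox (x k) (xt k) (v k) (eps k),
    xt k <> x k &
    exists2 beta, linesearch_step (x k) (xt k) (v k) (eps k) beta &
      x k.+1 = x k + beta *: ((xt k - v k) - x k)].

End IPG_ELS.

(* Main.v *)
Require Import Defs.
From HB Require Import structures.
From mathcomp Require Import all_boot all_order all_algebra.
From mathcomp Require Import all_classical all_reals all_analysis.
From mathcomp Require Import ring lra.

Set Implicit Arguments.
Unset Strict Implicit.
Unset Printing Implicit Defensive.

Import Order.TTheory GRing.Theory Num.Theory.
Import numFieldNormedType.Exports.
Local Open Scope classical_set_scope.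
Local Open Scope ring_scope.

(** Why the theorem is true.

    Write [u] for the [eps]-subgradient of [g] at [xt] hidden in the inclusion
    of the proximal step, so that [v = gradient f x + u + xt - x]. Substituting
    this into [w] leaves [w = gradient f xt + u], which is the first claim; the
    tangent inequality of the convex function [f], added to the
    [eps]-subgradient inequality of [g], gives the inclusion into the
    [eps]-subdifferential of [f + g].

    For the complexity bound put [y = xt - v], [x' = x + beta *: (y - x)] and
    [F = f + g]. Adding up the proximal inequality, the [eps]-subgradient
    inequality at [x], the line search test and the convexity of [g] along the
    segment from [x] to [y], every term in [eps] and [gradient f x] cancels and
    [F x' <= F x - beta / 2 * (|x - y|^2 + alpha * |x - xt|^2)]
    remains ([prox_decrease], [linesearch_decrease]). If the gradient is
    [L]-Lipschitz on the domain, the test succeeds as soon as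
    [beta * L <= tau / 4], so backtracking keeps [beta] above the constant
    [min 1 (theta * tau / (4 * L))] ([linesearch_step_ge]). As [F] is bounded
    below by its minimum, telescoping bounds the sum of the gaps
    [|x - y|^2 + alpha * |x - xt|^2], hence one of the first [n] gaps is
    [O(1/n)].

    A gap of at most [alpha * delta^2] forces [|w| = O(delta)] and
    [eps = O(delta^2)] ([residual_le]). With [delta] proportional to [eta] this
    is an [eta]-approximate stationary point, found among the first [O(1/eta^2)]
    iterates. *)

(** * Euclidean spaces and gradients *)

Lemma convex_combE {R : pzRingType} {V : lmodType R} (t : R) (a b : V) :
  t *: a + (1 - t) *: b = b + t *: (a - b).
Proof. by rewrite scalerBr scalerBl scale1r addrCA. Qed.

Section Euclidean.
Context {R : realType} {E : finDimNormedModType R} (dot : {dot E for idfun}).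

Lemma dotC (a b : E) : dot a b = dot b a.
Proof. by rewrite hermC expr0 mul1r. Qed.

Lemma dot_gt0 (a : E) : a != 0 -> 0 < dot a a.
Proof. exact: neq0_dnorm_gt0. Qed.

Lemma dotDr (a b c : E) : dot a (b + c) = dot a b + dot a c.
Proof. exact: linearDr. Qed.
Lemma dotNr (a b : E) : dot a (- b) = - dot a b.
Proof. exact: linearNr. Qed.
Lemma dotZr (t : R) (a b : E) : dot a (t *: b) = t * dot a b.
Proof. exact: linearZr_LR. Qed.
Lemma dotDl (a b c : E) : dot (a + b) c = dot a c + dot b c.
Proof. by rewrite dotC dotDr !(dotC c). Qed.
Lemma dotNl (a b : E) : dot (- a) b = - dot a b.
Proof. by rewrite dotC dotNr dotC. Qed.
Lemma dotZl (t : R) (a b : E) : dot (t *: a) b = t * dot a b.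
Proof. by rewrite dotC dotZr dotC. Qed.

(** The map sending [v] to the functional [dot v] is injective because [dot] is
    definite; domain and dual have the same dimension, so it is onto. *)
Lemma riesz (l : {linear E -> R^o}) : exists v : E, forall h, l h = dot v h.
Proof.
pose D (v : E) : {linear E -> R^o} := dot v.
pose T (v : E) : 'Hom(E, R^o) := linfun (D v).
have Tlin : linear T.
  move=> t a b; apply/lfunP => h.
  by rewrite !(add_lfunE, scale_lfunE) !lfunE /= dotDl dotZl.
pose T' : {linear E -> 'Hom(E, R^o)} :=
  HB.pack T (GRing.isLinear.Build _ _ _ _ T Tlin).
pose A := linfun T'.
have kA : lker A == 0%VS.
  apply/eqP/vspaceP => a; rewrite memv_ker memv0 lfunE /=; apply/eqP/eqP => [Ta|->].
    have [//|/dot_gt0] := eqVneq a 0; have := lfunE (D a) a.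
    by rewrite -/(T a) Ta zero_lfunE /D /= => <-; rewrite ltxx.
  by rewrite /T; apply/lfunP => h; rewrite lfunE /= zero_lfunE /D linear0l.
have [v _ Av] : exists2 v, v \in fullv & linfun l = A v.
  apply/memv_imgP.
  suff -> : limg A = fullv by exact: memvf.
  apply/eqP; rewrite eqEdim subvf limg_dim_eq ?(eqP kA) ?capv0 //=.
  by rewrite !dimvf -[X in (_ <= X)%N]muln1.
by exists v => h; rewrite -(lfunE l) Av lfunE /= /T lfunE.
Qed.

Lemma gradientE (f : E -> R) (a h : E) :
  'd f a h = dot (gradient dot f a) h.
Proof.
rewrite /gradient.
have := @getPex E [set v | forall h : E, 'd f a h = dot v h].
by apply; exact: riesz.
Qed.

(** The difference quotients along the segment from [a] to [b] are at most
    [f b - f a] by convexity, and so is their limit. *)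
Lemma convex_ge_tangent (f : E -> R) (a b : E) :
    differentiable f a -> convex_function [set: convex_lmodType E] f ->
  f a + dot (gradient dot f a) (b - a) <= f b.
Proof.
move=> fa fconvex; rewrite -gradientE -deriveE// -lerBrDl.
have /cvg_dnbhs_at_right := @diff_derivable _ _ _ f a (b - a) fa.
move/cvgr_to_le; apply; near=> t.
have t0 : 0 < t by near: t; exact: nbhs_right_gt.
have t1 : t <= 1 by near: t; exact: nbhs_right_le.
rewrite /= ler_pdivrMl// lerBlDl.
have fab : f (t *: b + (1 - t) *: a) <= t * f b + (1 - t) * f a.
  by apply: (fconvex (Itv01 (ltW t0) t1)); rewrite in_setT.
have -> : t *: (b - a) + a = t *: b + (1 - t) *: a.
  by rewrite convex_combE addrC.
by apply: le_trans fab _; lra.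
Unshelve. all: by end_near. Qed.

Context (norm_dot : forall a : E, `|a| = Num.sqrt (dot a a)).

Lemma sqr_normE (a : E) : `|a| ^+ 2 = dot a a.
Proof.
rewrite norm_dot sqr_sqrtr//.
by have [->|/dot_gt0/ltW//] := eqVneq a 0; rewrite linear0l.
Qed.

(** Cauchy-Schwarz, read off the squared triangle inequality. *)
Lemma dot_le_norm (a b : E) : dot a b <= `|a| * `|b|.
Proof.
have : `|a + b| ^+ 2 <= (`|a| + `|b|) ^+ 2.
  by rewrite lerXn2r ?nnegrE ?addr_ge0// ler_normD.
by rewrite sqr_normE sqrrD !sqr_normE dotDl !dotDr (dotC b a) -mulr_natr; lra.
Qed.

End Euclidean.

(** * Extended-valued convex functions *)

Section ExtendedValued.
Context {R : realType} {E : finDimNormedModType R} (dot : {dot E for idfun}).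
Context (g : E -> \bar R) (g_proper : eproper g).

Lemma edomP (a : E) : edom g a -> g a = (fine (g a))%:E.
Proof.
by move=> ga; rewrite fineK// fin_numE -ltey ga -ltNye g_proper.1.
Qed.

Lemma edom_convex (t : R) (a b : E) : econvex g -> 0 <= t <= 1 ->
  edom g a -> edom g b ->
  edom g (t *: a + (1 - t) *: b) /\
  fine (g (t *: a + (1 - t) *: b)) <= t * fine (g a) + (1 - t) * fine (g b).
Proof.
move=> g_convex t01 ga gb; have := g_convex t a b t01.
rewrite (edomP ga) (edomP gb) -!EFinM -EFinD => gab.
have dab : edom g (t *: a + (1 - t) *: b).
  by apply: le_lt_trans gab _; rewrite ltry.
by split=> //; rewrite -lee_fin -(edomP dab).
Qed.

Lemma eps_subdiff_fine (eps : R) (a b u : E) :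
  eps_subdiff dot eps g a u -> edom g b ->
  fine (g a) + dot u (b - a) - eps <= fine (g b).
Proof.
by move=> [ga gu] gb; rewrite -lee_fin -(edomP gb) !EFinD -(edomP ga).
Qed.

(** The sum of the tangent inequality of [f] and the [eps]-subgradient
    inequality of [g]. *)
Lemma grad_plus_eps_subdiff_sub (f : E -> R) (eps : R) (a : E) :
  differentiable f a -> convex_function [set: convex_lmodType E] f ->
  grad_plus_eps_subdiff dot f g eps a `<=` eps_subdiff dot eps (objective f g) a.
Proof.
move=> fa fconvex _ [u [ga gu] <-]; split=> [|b].
  by rewrite /edom /objective /= (edomP ga) -EFinD ltry.
have [gb|gb] := pselect (edom g b); last first.
  rewrite /objective; suff -> : g b = +oo%E by rewrite addey// leey.
  by apply/eqP; rewrite -leye_eq leNgt; apply/negP.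
rewrite /objective (edomP ga) (edomP gb) -!EFinD lee_fin.
have := convex_ge_tangent dot b fa fconvex.
have := eps_subdiff_fine (conj ga gu) gb.
rewrite dotDl; lra.
Qed.

End ExtendedValued.

(** * One iteration *)

Section Step.
Context {R : realType} {E : finDimNormedModType R} (dot : {dot E for idfun}).
Context (norm_dot : forall a : E, `|a| = Num.sqrt (dot a a)).
Context (f : E -> R) (g : E -> \bar R) (g_proper : eproper g).
Context (tau gamma1 gamma2 alpha : R) (x xt v : E) (eps : R).
Context (prox : inexact_prox dot f g tau gamma1 gamma2 alpha x xt v eps).

Let G := fine \o g.
Let y := xt - v.

(** The proximal inequality bounds [g y] by a finite quantity, so the trial
    point [y] cannot leave the domain. *)
Lemma inexact_prox_edom : edom g xt /\ edom g y.
Proof.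
case: prox => _ [u [gxt _] _]; rewrite -/y (edomP g_proper gxt) => gy.
by split=> //; rewrite /edom /=; case: (g y) gy => // r _; rewrite ltry.
Qed.

Lemma inexact_prox_fine : G y <= G xt
  + dot (gradient dot f x) v - (1 + gamma1) / 2 * `|v| ^+ 2 - (1 + gamma2) * eps
  + (1 - tau - alpha) / 2 * `|x - xt| ^+ 2.
Proof.
have [gxt gy] := inexact_prox_edom; case: prox => _ _.
rewrite -/y (edomP g_proper gxt) (edomP g_proper gy) -!EFinD lee_fin /G /=; lra.
Qed.

(** Minus [g x], the left-hand side bounds the change of [f + g] per unit of
    step length that the line search test and the convexity of [g] permit. The
    proximal inequality and the [eps]-subgradient inequality at [x] eliminate
    [g xt] and [eps]; the remaining inner products are
    [dot (v + x - xt) (xt - x) - |v|^2 / 2 + (1 - alpha) / 2 * |x - xt|^2],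
    and completing the square turns them into [|x - y|^2]. *)
Lemma prox_decrease : edom g x ->
  G y + dot (gradient dot f x) (y - x) + tau / 2 * `|x - xt| ^+ 2
    + gamma1 / 2 * `|v| ^+ 2 + gamma2 * eps
  <= G x - (`|x - y| ^+ 2 + alpha * `|x - xt| ^+ 2) / 2.
Proof.
move=> gx; have := inexact_prox_fine.
case: prox => _ [u gu vE] _; have := eps_subdiff_fine g_proper gu gx.
have uE (c : E) :
    dot u c = dot v c - dot (gradient dot f x) c - dot xt c + dot x c.
  by rewrite -vE !(dotDl, dotNl); lra.
rewrite uE !(sqr_normE norm_dot) /y /G /= !(dotDl, dotDr, dotNl, dotNr).
rewrite (dotC dot xt x) (dotC dot v x) (dotC dot v xt); lra.
Qed.

(** Comparing the proximal inequality with the [eps]-subgradient inequality at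
    [y] cancels [g] and leaves an upper bound on [gamma2 * eps] that is
    quadratic in [v] and [x - xt]. *)
Lemma residual_eps_le : 1 <= gamma1 -> 1 <= gamma2 -> 0 <= tau + alpha ->
  eps <= `|x - xt| * `|v| + `|x - xt| ^+ 2 / 2.
Proof.
move=> gamma1_ge1 gamma2_ge1 ta_ge0; have := inexact_prox_fine.
have [_ gy] := inexact_prox_edom; case: prox => eps0 [u gu vE] _.
have := eps_subdiff_fine g_proper gu gy.
have uE (c : E) :
    dot u c = dot v c - dot (gradient dot f x) c - dot xt c + dot x c.
  by rewrite -vE !(dotDl, dotNl); lra.
have := dot_le_norm norm_dot (x - xt) v.
have -> : y - xt = - v by rewrite /y addrAC subrr add0r.
rewrite uE !dotNr dotDl dotNl -(sqr_normE norm_dot v) /G /=.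
set P := `|x - xt|; set V := `|v|; set e1 := fine _; set e2 := fine _.
have : 0 <= (tau + alpha) * P ^+ 2 by rewrite mulr_ge0// sqr_ge0.
have : 0 <= (gamma1 - 1) * V ^+ 2 by rewrite mulr_ge0 ?sqr_ge0// subr_ge0.
have : 0 <= (gamma2 - 1) * eps by rewrite mulr_ge0// subr_ge0.
lra.
Qed.

Lemma residual_subdiff :
  grad_plus_eps_subdiff dot f g eps xt
    (v + x - xt + gradient dot f xt - gradient dot f x).
Proof.
case: prox => _ [u gu <-] _; exists u => //.
move: (gradient dot f x) (gradient dot f xt) => d dt.
by rewrite subrK addrK [RHS]addrAC (addrC d) addrK addrC.
Qed.

Lemma linesearch_decrease (beta : R) : econvex g -> edom g x ->
    0 <= beta <= 1 -> linesearch_test dot f tau gamma1 gamma2 x xt v eps beta ->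
  edom g (x + beta *: (y - x)) /\
  f (x + beta *: (y - x)) + G (x + beta *: (y - x)) <=
    f x + G x - beta / 2 * (`|x - y| ^+ 2 + alpha * `|x - xt| ^+ 2).
Proof.
move=> g_convex gx beta01 fdec.
have [_ gy] := inexact_prox_edom.
have [gnext Gnext] := edom_convex g_proper g_convex beta01 gy gx.
rewrite convex_combE in gnext Gnext; split=> //.
move: fdec Gnext; rewrite /linesearch_test -/y /G /=.
have := ler_wpM2l (proj1 (andP beta01)) (prox_decrease gx); rewrite /G /=; lra.
Qed.

Section Lipschitz.
Context (f_diff : forall a, differentiable f a).
Context (f_convex : convex_function [set: convex_lmodType E] f).
Context (g_convex : econvex g) (x_dom : edom g x) (L : R) (L_gt0 : 0 < L).
Context (f_lip : forall a b, edom g a -> edom g b ->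
  `|gradient dot f a - gradient dot f b| <= L * `|a - b|).

(** With [d = y - x], the tangent inequality at [x + beta *: d] bounds the
    error of the linear model of [f] by
    [beta * dot (gradient f (x + beta *: d) - gradient f x) d], at most
    [beta^2 * L * |d|^2]; the parallelogram law then compares [|d|^2] with
    [|x - xt|^2 + |v|^2], which the test tolerates. Convexity thus replaces the
    integral form of the descent lemma, at the price of a factor 2. *)
Lemma linesearch_test_small (beta : R) :
    0 < tau <= 1 -> 1 <= gamma1 -> 0 <= gamma2 -> 0 <= beta <= 1 ->
    beta * L <= tau / 4 ->
  linesearch_test dot f tau gamma1 gamma2 x xt v eps beta.
Proof.
move=> tau01 gamma1_ge1 gamma2_ge0 beta01 betaL; rewrite /linesearch_test -/y.
have eps0 : 0 <= eps by case: prox.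
have [_ gy] := inexact_prox_edom; set d := y - x.
have [gnext _] := edom_convex g_proper g_convex beta01 gy x_dom.
rewrite convex_combE -/d in gnext.
have := f_lip gnext x_dom.
have := convex_ge_tangent dot x (f_diff (x + beta *: d)) f_convex.
move: (gradient dot f (x + beta *: d)) (gradient dot f x) => A B.
have -> : x - (x + beta *: d) = - (beta *: d) by rewrite opprD addrA subrr add0r.
have -> : x + beta *: d - x = beta *: d by rewrite addrC addKr.
case/andP: beta01 => beta0 beta1; case/andP: tau01 => tau0 tau1.
rewrite dotNr dotZr lerBlDr normrZ ger0_norm// => tangent lip.
apply: le_trans tangent _; rewrite -!addrA lerD2l.
have curv : dot (A - B) d <= tau / 4 * `|d| ^+ 2.
  apply: le_trans (dot_le_norm norm_dot _ _) _.
  apply: le_trans (ler_wpM2r (normr_ge0 _) lip) _.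
  have -> : L * (beta * `|d|) * `|d| = beta * L * `|d| ^+ 2 by ring.
  by rewrite ler_wpM2r ?sqr_ge0.
have d2 : `|d| ^+ 2 <= 2 * (`|x - xt| ^+ 2 + `|v| ^+ 2).
  have := sqr_normE norm_dot (x - xt - v); have := sqr_ge0 `|x - xt - v|.
  rewrite !(sqr_normE norm_dot) /d /y !(dotDl, dotDr, dotNl, dotNr).
  rewrite (dotC dot xt x) (dotC dot v x) (dotC dot v xt).
  lra.
(* This is where tau <= 1 <= gamma1 enters. *)
have gain : dot (A - B) d
    <= tau / 2 * `|x - xt| ^+ 2 + gamma1 / 2 * `|v| ^+ 2 + gamma2 * eps.
  apply: le_trans curv _; apply: le_trans (ler_wpM2l _ d2) _.
    by rewrite divr_ge0// ltW.
  rewrite ler_wpDr ?mulr_ge0//.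
  have -> : tau / 4 * (2 * (`|x - xt| ^+ 2 + `|v| ^+ 2)) =
    tau / 2 * `|x - xt| ^+ 2 + tau / 2 * `|v| ^+ 2 by field.
  by rewrite lerD2l ler_wpM2r ?sqr_ge0// ler_wpM2r ?invr_ge0// (le_trans tau1).
rewrite -lerBlDl -mulrBr -dotNl -dotDl.
apply: le_trans (ler_wpM2l beta0 gain) _.
by rewrite le_eqVlt; apply/orP; left; apply/eqP; field.
Qed.

(** Either the unit step passes, or the step before the accepted one was
    rejected and hence exceeded [tau / (4 * L)]. *)
Lemma linesearch_step_ge (theta beta : R) :
    0 < tau <= 1 -> 1 <= gamma1 -> 0 <= gamma2 -> 0 < theta < 1 ->
    linesearch_step dot f tau theta gamma1 gamma2 x xt v eps beta ->
  Num.min 1 (theta * tau / (4 * L)) <= beta.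
Proof.
move=> tau01 gamma1_ge1 gamma2_ge0 /andP[theta0 theta1] [[|j] [-> _ fail]].
  by rewrite expr0 ge_min lexx.
rewrite ge_min; apply/orP; right; rewrite exprS -mulrA ler_pM2l//.
rewrite leNgt; apply/negP => small; apply: (fail j) => //.
apply: linesearch_test_small => //.
  by rewrite exprn_ge0 ?exprn_ile1// ltW.
by move: small; rewrite ltr_pdivlMr ?mulr_gt0// => small; apply: ltW; lra.
Qed.

(** Since [alpha <= 1], a small gap controls both [x - y] and [x - xt], hence
    their difference [v]; [w] and [eps] follow. *)
Lemma residual_le (delta : R) :
    1 <= gamma1 -> 1 <= gamma2 -> 0 <= tau -> 0 < alpha <= 1 -> 0 <= delta ->
    `|x - y| ^+ 2 + alpha * `|x - xt| ^+ 2 <= alpha * delta ^+ 2 ->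
  `|v + x - xt + gradient dot f xt - gradient dot f x| <= (3 + L) * delta /\
  eps <= 3 * delta ^+ 2.
Proof.
move=> gamma1_ge1 gamma2_ge1 tau0 /andP[alpha0 alpha1] delta0 small.
have P_le : `|x - xt| <= delta.
  rewrite -(@ler_pXn2r _ 2) ?nnegrE// -(ler_pM2l alpha0).
  by apply: le_trans small; rewrite lerDr sqr_ge0.
have Q_le : `|x - y| <= delta.
  rewrite -(@ler_pXn2r _ 2) ?nnegrE//; have := sqr_ge0 `|x - xt|.
  have := sqr_ge0 delta; move: small; nra.
have V_le : `|v| <= 2 * delta.
  have -> : v = x - y - (x - xt).
    by rewrite /y !opprB !addrA subrK addrAC subrr add0r.
  by apply: le_trans (ler_normB _ _) _; lra.
split; last first.
  have := residual_eps_le gamma1_ge1 gamma2_ge1 (addr_ge0 tau0 (ltW alpha0)).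
  have := ler_pM (normr_ge0 _) (normr_ge0 _) P_le V_le.
  have := lerXn2r 2 (normr_ge0 (x - xt)) delta0 P_le.
  have := sqr_ge0 delta.
  lra.
have [gxt _] := inexact_prox_edom.
have lip := f_lip gxt x_dom.
have -> : v + x - xt + gradient dot f xt - gradient dot f x =
    v + (x - xt) + (gradient dot f xt - gradient dot f x) by rewrite !addrA.
apply: le_trans (ler_normD _ _) _.
apply: le_trans (lerD (ler_normD _ _) lip) _.
rewrite (distrC xt); have := ler_wpM2l (ltW L_gt0) P_le; lra.
Qed.

End Lipschitz.
End Step.

(** * Infinite runs *)

Lemma exists_le_mean {R : realDomainType} (a : nat -> R) (c : R) (n : nat) :
  \sum_(i < n.+1) a i <= c *+ n.+1 -> exists2 k, (k <= n)%N & a k <= c.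
Proof.
move=> sum_le; apply: contrapT => nex; move: sum_le; apply/negP; rewrite -ltNge.
have -> : c *+ n.+1 = \sum_(i < n.+1) c by rewrite sumr_const card_ord.
apply: ltr_sum; first by apply/hasP; exists ord0; rewrite ?mem_index_enum.
move=> i _; rewrite ltNge; apply/negP => le_c; apply: nex; exists i => //.
by rewrite -ltnS.
Qed.

Section Run.
Context {R : realType} {E : finDimNormedModType R} (dot : {dot E for idfun}).
Context (norm_dot : forall a : E, `|a| = Num.sqrt (dot a a)).
Context (f : E -> R) (g : E -> \bar R) (g_proper : eproper g).
Context (f_diff : forall a, differentiable f a).
Context (f_convex : convex_function [set: convex_lmodType E] f).
Context (g_convex : econvex g).
Context (x0 : E) (tau theta gamma1 gamma2 alpha : R).
Context (x0_dom : edom g x0) (tau01 : 0 < tau <= 1) (theta01 : 0 < theta < 1).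
Context (gamma1_ge1 : 1 <= gamma1) (gamma2_ge1 : 1 <= gamma2).
Context (x xt v : nat -> E) (eps : nat -> R).
Context (run : ipg_els_run dot f g tau theta gamma1 gamma2 alpha
  x0 x xt v eps).

Let F k := f (x k) + fine (g (x k)).
Let gap k := `|x k - (xt k - v k)| ^+ 2 + alpha * `|x k - xt k| ^+ 2.

Lemma linesearch_step_itv k beta :
  linesearch_step dot f tau theta gamma1 gamma2 (x k) (xt k) (v k) (eps k) beta ->
  0 <= beta <= 1.
Proof.
by case/andP: theta01 => t0 t1 [j [-> _ _]]; rewrite exprn_ge0 ?exprn_ile1// ltW.
Qed.

Lemma run_edom k : edom g (x k).
Proof.
have [x0E step] := run; elim: k => [|k IHk]; first by rewrite x0E.
have [prox _ [beta ls ->]] := step k; have [j [betaE test _]] := ls.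
rewrite -betaE in test.
by have [] := linesearch_decrease norm_dot g_proper prox g_convex IHk
  (linesearch_step_itv ls) test.
Qed.

Context (alpha_gt0 : 0 < alpha) (L : R) (L_gt0 : 0 < L).
Context (f_lip : forall a b, edom g a -> edom g b ->
  `|gradient dot f a - gradient dot f b| <= L * `|a - b|).

Let b := Num.min 1 (theta * tau / (4 * L)).

Lemma run_decrease k : F k.+1 <= F k - b / 2 * gap k.
Proof.
have [_ step] := run; have [prox _ [beta ls xE]] := step k.
have [j [betaE test _]] := ls.
rewrite -betaE in test.
have [_] := linesearch_decrease norm_dot g_proper prox g_convex (run_edom k)
  (linesearch_step_itv ls) test.
rewrite -xE -/(F k) -/(F k.+1) -/(gap k) => /le_trans; apply.
rewrite lerD2l lerN2 ler_wpM2r ?ler_wpM2r ?invr_ge0//.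
  by rewrite addr_ge0 ?mulr_ge0 ?sqr_ge0// ltW.
apply: (linesearch_step_ge norm_dot g_proper prox f_diff f_convex g_convex
  (run_edom k) L_gt0 f_lip) ls => //.
exact: le_trans ler01 gamma2_ge1.
Qed.

Lemma run_sum n : b / 2 * (\sum_(i < n) gap i) <= F 0 - F n.
Proof.
elim: n => [|n IHn]; first by rewrite big_ord0 mulr0 subrr.
rewrite big_ord_recr /= mulrDr; have := run_decrease n; lra.
Qed.

End Run.

(** * Stationarity and complexity *)

Theorem theorem5p3 (R : realType) (E : finDimNormedModType R)
    (dot : {dot E for idfun})
    (norm_dot : forall x : E, `|x| = Num.sqrt (dot x x))
    (f : E -> R) (g : E -> \bar R)
    (g_proper : eproper g) (g_lsc : lower_semicontinuous g)
    (g_convex : econvex g)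
    (f_C1 : continuously_differentiable dot f)
    (f_convex : convex_function [set: convex_lmodType E] f)
    (S_neq0 : eminimizers (objective f g) !=set0)
    (x0 : E) (tau theta gamma1 gamma2 alpha : R)
    (x0_dom : edom g x0)
    (tau01 : 0 < tau <= 1) (theta01 : 0 < theta < 1)
    (gamma1_gt1 : 1 < gamma1) (gamma2_ge1 : 1 <= gamma2)
    (alpha_ge0 : 0 <= alpha <= 1 - tau)
    (x xt v : nat -> E) (eps : nat -> R)
    (run : ipg_els_run dot f g tau theta gamma1 gamma2 alpha x0 x xt v eps) :
  let w := fun k : nat =>
    v k + x k - xt k + gradient dot f (xt k) - gradient dot f (x k) in
  (forall k : nat,
     grad_plus_eps_subdiff dot f g (eps k) (xt k) (w k) /\
     grad_plus_eps_subdiff dot f g (eps k) (xt k)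
       `<=` eps_subdiff dot (eps k) (objective f g) (xt k)) /\
  (0 < alpha < 1 - tau ->
   forall L : R, L.-lipschitz_(edom g) (gradient dot f) ->
   exists2 C : R, 0 < C &
     \forall eta \near 0^'+, exists k : nat,
       k%:R <= C / eta ^+ 2 /\
       approx_stationary dot f g eta (xt k) (w k) (eps k)).
Proof.
move=> w; have [f_diff _] := f_C1; have [_ step] := run.
split=> [k|].
  have [prox _ _] := step k; split; first exact: residual_subdiff prox.
  exact: grad_plus_eps_subdiff_sub.
move=> /andP[alpha0 alpha_lt] L0 f_lip0.
have alpha1 : alpha <= 1 by case/andP: tau01 => tau0 _; lra.
have gamma1_ge1 := ltW gamma1_gt1.
(* The given constant may be zero or negative; the step bound divides by it. *)
pose L := `|L0| + 1.
have L_gt0 : 0 < L by rewrite ltr_wpDl.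
have f_lip a b : edom g a -> edom g b ->
    `|gradient dot f a - gradient dot f b| <= L * `|a - b|.
  move=> ga gb; apply: le_trans (f_lip0 (a, b) (conj ga gb)) _ => /=.
  by rewrite ler_wpM2r// (le_trans (ler_norm _))// lerDl.
have dom := run_edom norm_dot g_proper g_convex x0_dom theta01 run.
pose F k := f (x k) + fine (g (x k)).
have [s smin] := S_neq0.
have gs : edom g s.
  have := smin (x 0%N).
  rewrite /objective (edomP g_proper (dom 0%N)) -EFinD /edom /=.
  by have := g_proper.1 s; case: (g s) => // r; rewrite ltry.
pose Fs := f s + fine (g s).
have Fs_le k : Fs <= F k.
  have := smin (x k).
  by rewrite /objective (edomP g_proper (dom k)) (edomP g_proper gs) -!EFinD lee_fin.
set b := Num.min 1 (theta * tau / (4 * L)).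
have b_gt0 : 0 < b.
  case/andP: tau01 => tau0 _; case/andP: theta01 => theta0 _.
  by rewrite lt_min ltr01 divr_gt0 ?mulr_gt0.
(* The summand 1 keeps C positive when x0 is already a minimizer. *)
pose D := F 0%N - Fs + 1.
have D_gt0 : 0 < D by rewrite ltr_wpDl// subr_ge0.
(* C is chosen so that D = b / 2 * (alpha * delta ^+ 2) * (C / eta ^+ 2). *)
pose C := 2 * D * (3 + L) ^+ 2 / (b * alpha).
have L3 : 0 < 3 + L by rewrite addr_gt0.
have C_gt0 : 0 < C by rewrite divr_gt0 ?mulr_gt0 ?exprn_gt0.
exists C => //; near=> eta.
have eta_gt0 : 0 < eta by near: eta; exact: nbhs_right_gt.
have eta_le1 : eta <= 1 by near: eta; exact: nbhs_right_le.
pose delta := eta / (3 + L); pose n := Num.truncn (C / eta ^+ 2).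
have delta_ge0 : 0 <= delta by rewrite divr_ge0// ltW.
pose gap k := `|x k - (xt k - v k)| ^+ 2 + alpha * `|x k - xt k| ^+ 2.
have [k kn gap_le] : exists2 k, (k <= n)%N & gap k <= alpha * delta ^+ 2.
  apply: exists_le_mean.
  have sum_le := run_sum norm_dot g_proper f_diff f_convex g_convex x0_dom
    tau01 theta01 gamma1_ge1 gamma2_ge1 run alpha0 L_gt0 f_lip n.+1.
  have b2 : 0 < b / 2 by rewrite divr_gt0.
  rewrite -(ler_pM2l b2); apply: le_trans sum_le _.
  have := truncnS_gt (C / eta ^+ 2); rewrite -/n => n_gt.
  have : D <= b / 2 * (alpha * delta ^+ 2 *+ n.+1).
    rewrite -[_ *+ n.+1]mulr_natr.
    have -> : D = b / 2 * (alpha * delta ^+ 2 * (C / eta ^+ 2)).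
      by rewrite /C /delta; field; rewrite !gt_eqF.
    rewrite ler_pM2l//; apply: ler_wpM2l (ltW n_gt).
    by rewrite mulr_ge0 ?sqr_ge0// ltW.
  by apply: le_trans; have := Fs_le n.+1; rewrite /D /F; lra.
exists k; split.
  have := truncn_le (C / eta ^+ 2).
  rewrite divr_ge0 ?sqr_ge0 ?(ltW C_gt0)// => n_le.
  by apply: le_trans n_le; rewrite ler_nat.
have [prox _ _] := step k; have [gxt _] := inexact_prox_edom g_proper prox.
split=> //; first exact: residual_subdiff prox.
have tau_ge0 : 0 <= tau by case/andP: tau01 => /ltW.
have alpha01 : 0 < alpha <= 1 by rewrite alpha0.
have [w_le eps_le] := residual_le norm_dot g_proper prox (dom k) L_gt0 f_lip
  gamma1_ge1 gamma2_ge1 tau_ge0 alpha01 delta_ge0 gap_le.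
have deltaE : (3 + L) * delta = eta by rewrite /delta mulrCA mulfV ?gt_eqF// mulr1.
rewrite ge_max; apply/andP; split; first by rewrite -deltaE.
apply: le_trans eps_le _.
(* eps is quadratic in delta, so it is below eta once eta <= 1. *)
have : 3 * delta <= eta by rewrite -deltaE ler_wpM2r// lerDl ltW.
have : delta <= 1 by nra.
nra.
Unshelve. all: by end_near. Qed.
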